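(* For every Banach space $X$ and every compact set $K\subset X$ we have $$d_n^r(K)_X\le (1+\sqrt n)\,d_n(K)_X,\qquad n\ge 0.$$ When $X$ is a Hilbert space, we have $$d_n^r(K)_X=d_n(K)_X,\qquad n\ge 0.$$
   Context: Let $K$ be a compact subset of a Banach space $X$. The Kolmogorov widths are $d_0(K)_X:=\sup_{f\in K}\|f\|_X$ and, for $n\ge1$, $$d_n(K)_X:=\inf_{V\subset X,\ \dim V\le n}\ \sup_{f\in K}\ \inf_{v\in V}\|f-v\|_X,$$ the outer infimum being over linear subspaces $V$ of $X$. Let $\mathcal{X}(K)$ be the closure in $X$ of the linear span of $K$. The restricted Kolmogorov widths are $d_0^r(K)_X:=\sup_{f\in K}\|f\|_X$ and, for $n\ge 1$, $$d_n^r(K)_X:=\inf_{V\subset \mathcal{X}(K),\ \dim V\le n}\ \sup_{f\in K}\ \inf_{v\in V}\|f-v\|_X,$$ the outer infimum being over linear subspaces $V$ of $\mathcal{X}(K)$. *)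

(* Defs.v *)
From mathcomp Require Import all_boot all_order all_algebra.
From mathcomp Require Import all_classical all_reals all_analysis.
From mathcomp Require Import complex.

Set Implicit Arguments.
Unset Strict Implicit.
Unset Printing Implicit Defensive.
Import Order.TTheory GRing.Theory Num.Theory.
Import numFieldNormedType.Exports.
Local Open Scope classical_set_scope.
Local Open Scope ring_scope.

(* Banach spaces are taken over either of the two usual scalar fields. *)
Inductive scalars := RealScalars | ComplexScalars.

Definition scalar_field (R : realType) (s : scalars) : numFieldType :=
  match s with RealScalars => R | ComplexScalars => R[i] end.

Definition scalar_conj (R : realType) (s : scalars) :
    scalar_field R s -> scalar_field R s :=
  match s with RealScalars => idfun | ComplexScalars => @conjc R end.

Definition scalar_Re (R : realType) (s : scalars) : scalar_field R s -> R :=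
  match s with RealScalars => idfun | ComplexScalars => @complex.Re R end.

Section Widths.
Context {R : realType} {s : scalars} {X : normedModType (scalar_field R s)}.
Implicit Types (K V Y : set X) (n : nat).

(* `|x| lives in the scalar field, which need not be totally ordered. *)
Definition rnorm (x : X) : R := scalar_Re `|x|.

Definition linear_subspace V : Prop := submod_closed [in V].

Definition linear_span (A : set X) : set X := smallest linear_subspace A.

Definition dim_le V n : Prop :=
  exists v : 'I_n -> X, V = linear_span (range v).

Definition dist_to V (f : X) : R := inf [set rnorm (f - v) | v in V].

(* The real-valued sup and inf are the genuine ones when K is bounded, in
   particular compact; the empty set has all widths 0 because sup set0 = 0. *)
Definition width_in Y n K : R :=
  match n with
  | 0%N => sup [set rnorm f | f in K]
  | _ => inf [set sup [set dist_to V f | f in K] |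
                V in [set V | [/\ linear_subspace V, V `<=` Y & dim_le V n]]]
  end.

Definition kolmogorov_width n K : R := width_in setT n K.

Definition restricted_kolmogorov_width n K : R :=
  width_in (closure (linear_span K)) n K.

(* {dot X for theta} is linear in its first argument, theta-linear in its second,
   hermitian and positive definite; completeness is left to the type of X. *)
Definition is_hilbert : Prop :=
  exists ip : {dot X for @scalar_conj R s}, forall x : X, `|x| ^+ 2 = ip x x.

End Widths.
Arguments is_hilbert {R s} X.

(* Main.v *)
(* For f in K let v_f be a point of an n-dimensional space V with
   |f - v_f| <= d.  If functionals psi_g on V satisfy
   v_f = sum_g psi_g(v_f) v_g and sum_g |psi_g(v_f)| <= c, then the points
   w_f = sum_g psi_g(v_f) g of span(K) lie in an at most n-dimensional space,
   and f - w_f = (f - v_f) - sum_g psi_g(v_f) (g - v_g) has norm at most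
   (1 + c) d.
   A near D-optimal design, that is weights m_g of total mass at most 1 that
   nearly maximize |det M| for M = sum_g m_g v_g^* v_g, provides
   psi_g(v) = m_g v M^-1 v_g^*: by Cauchy-Schwarz c^2 is at most the largest
   v_f M^-1 v_f^*, which near optimality bounds by nearly n.  (This replaces the
   Kadec-Snobar theorem.)  In a Hilbert space, projecting V orthogonally onto
   the span of a finite net of K does not increase the distances to the net. *)

Require Import Defs.
From HB Require Import structures.
From mathcomp Require Import all_boot all_order all_algebra.
From mathcomp Require Import all_classical all_reals all_analysis.
From mathcomp Require Import complex perm ring lra.

Set Implicit Arguments.
Unset Strict Implicit.
Unset Printing Implicit Defensive.
Import Order.TTheory GRing.Theory Num.Theory.
Import numFieldNormedType.Exports.
Local Open Scope classical_set_scope.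
Local Open Scope ring_scope.

(** * Uniform treatment of real and complex scalars *)

Section Scalars.
Context {R : realType} {s : scalars}.
Local Notation F := (scalar_field R s).
Implicit Types (x y z : F) (a b : R).

(** Packaged as a ring morphism so that the generic [rmorph] rules carry real computations into
    either field. *)
Definition scalar_of : {rmorphism R -> F} :=
  match s return {rmorphism R -> scalar_field R s} with
  | RealScalars => (idfun : {rmorphism R -> R})
  | ComplexScalars => (real_complex R : {rmorphism R -> R[i]})
  end.

Lemma scalar_ofK : cancel scalar_of (@scalar_Re R s).
Proof. by rewrite /scalar_of; case: s. Qed.

Lemma scalar_ReK x : 0 <= x -> scalar_of (scalar_Re x) = x.
Proof.
rewrite /scalar_of; case: s x => //= x x0.
by apply: RRe_real; rewrite ger0_real.
Qed.

Lemma scalar_of_le a b : (scalar_of a <= scalar_of b) = (a <= b).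
Proof. by rewrite /scalar_of; case: s => //=; rewrite lecR. Qed.

Lemma scalar_of_lt a b : (scalar_of a < scalar_of b) = (a < b).
Proof.
by rewrite !lt_neqAle scalar_of_le (inj_eq (can_inj scalar_ofK)).
Qed.

Lemma scalar_Re_le x y : x <= y -> scalar_Re x <= scalar_Re y.
Proof. by case: s x y => //= x y; rewrite lecE => /andP[]. Qed.

Lemma scalar_conj_is_zmod_morphism : zmod_morphism (@scalar_conj R s).
Proof. by case: s => //= x y; exact: rmorphB. Qed.

Lemma scalar_conj_is_monoid_morphism : monoid_morphism (@scalar_conj R s).
Proof.
case: s => //=; split; [exact: rmorph1|exact: rmorphM].
Qed.

HB.instance Definition _ :=
  GRing.isZmodMorphism.Build F F (@scalar_conj R s)
    scalar_conj_is_zmod_morphism.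
HB.instance Definition _ :=
  GRing.isMonoidMorphism.Build F F (@scalar_conj R s)
    scalar_conj_is_monoid_morphism.

Lemma scalar_conjK : involutive (@scalar_conj R s).
Proof. by case: s => //= x; exact: conjcK. Qed.

Lemma mul_scalar_conj x : x * scalar_conj x = `|x| ^+ 2.
Proof.
case: s x => /= x; last by rewrite sqr_normc.
by rewrite real_normK ?num_real // expr2.
Qed.

Lemma scalar_conj_ge0 x : 0 <= x -> scalar_conj x = x.
Proof.
case: s x => //= x /ger0_real /RRe_real <-; exact: conjc_real.
Qed.

(** Near maximality replaces attainment: the supremum need not be reached, but since [c] exceeds 1
    some value lies above the supremum divided by [c]. The supremum is taken over real parts because
    the order of the scalar field may be partial. *)
Lemma exists_near_max (T : Type) (P : T -> Prop) (h : T -> F) (B c : F) :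
  (forall u, P u -> 0 <= h u <= B) -> (exists2 u, P u & 0 < h u) -> 1 < c ->
  exists u, [/\ P u, 0 < h u & forall v, P v -> h v <= c * h u].
Proof.
move=> hB [u0 Pu0 hu0] c1.
pose S := [set scalar_Re (h u) | u in P].
have Sub v : P v -> scalar_Re (h v) <= sup S.
  move=> Pv; apply: ub_le_sup; last by exists v.
  exists (scalar_Re B) => _ [w Pw <-]; apply: scalar_Re_le.
  by case/andP: (hB w Pw).
have h0 u : P u -> 0 <= h u by move/hB => /andP[].
have c0 : 0 < c := lt_trans ltr01 c1.
have S0 : 0 < sup S.
  apply: lt_le_trans (Sub u0 Pu0).
  by rewrite -scalar_of_lt rmorph0 scalar_ReK ?ltW.
have cRe : 1 < scalar_Re c.
  by rewrite -scalar_of_lt rmorph1 scalar_ReK ?ltW.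
have cRe0 : 0 < scalar_Re c := lt_trans ltr01 cRe.
have [||_ [u Pu <-] hu] := @sup_adherent _ S (sup S - sup S / scalar_Re c).
- by rewrite subr_gt0 ltr_pdivrMr // ltr_pMr.
- split; first by exists (scalar_Re (h u0)), u0.
  by exists (sup S) => _ [w Pw <-]; exact: Sub.
move: hu; rewrite opprB addrC subrK => hu; exists u; split=> //.
  rewrite -(scalar_ReK (h0 u Pu)) -(rmorph0 scalar_of) scalar_of_lt.
  by apply: lt_trans hu; rewrite divr_gt0.
move=> v Pv; rewrite -(scalar_ReK (h0 v Pv)) -(scalar_ReK (h0 u Pu)).
rewrite -{1}(scalar_ReK (ltW c0)) -rmorphM scalar_of_le.
move: hu; rewrite ltr_pdivrMr // mulrC => hu.
exact: le_trans (Sub v Pv) (ltW hu).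
Qed.

End Scalars.

(** * Rank-one determinant updates and scalar inequalities *)

(** The block matrix [B] has two block-triangular factorizations, one for each Schur complement;
    compare their determinants. *)
Lemma det_add1_rank1 (F : comNzRingType) n (u : 'cV[F]_n) (w : 'rV[F]_n) :
  \det (1%:M + u *m w) = 1 + (w *m u) 0 0.
Proof.
pose B : 'M[F]_(n + 1) := block_mx 1%:M (- u) w 1%:M.
have E1 : B = block_mx 1%:M 0 w 1%:M *m block_mx 1%:M (- u) 0 (1%:M + w *m u).
  rewrite mulmx_block !mul1mx ?mulmx1 ?mul0mx ?mulmx0 ?addr0.
  by rewrite mulmxN addrC addrK.
have E2 : B = block_mx (1%:M + u *m w) (- u) 0 1%:M *m block_mx 1%:M 0 w 1%:M.
  rewrite mulmx_block !mul1mx ?mulmx1 ?mul0mx ?mulmx0 ?add0r.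
  by rewrite mulNmx addrK.
have := congr1 determinant E1; rewrite E2 !det_mulmx !det_ublock !det_lblock.
by rewrite !det1 !mul1r !mulr1 => ->; rewrite det_mx11 !mxE eqxx.
Qed.

Lemma det_add_rank1 (F : fieldType) n (M : 'M[F]_n) (u : 'cV[F]_n)
    (w : 'rV[F]_n) (t : F) : M \in unitmx -> t != 1 ->
  \det ((1 - t) *: M + t *: (u *m w)) =
  (1 - t) ^+ n * \det M * (1 + t / (1 - t) * (w *m invmx M *m u) 0 0).
Proof.
move=> uM t1; have t10 : 1 - t != 0 by rewrite subr_eq0 eq_sym.
have -> : (1 - t) *: M + t *: (u *m w) =
    (1 - t) *: (M *m (1%:M + (invmx M *m u) *m ((t / (1 - t)) *: w))).
  rewrite mulmxDr mulmx1 scalerDr -!scalemxAr scalerA !mulmxA mulmxV // mul1mx.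
  by rewrite mulrC divfK.
rewrite detZ det_mulmx det_add1_rank1 mulrA -scalemxAl mulmxA.
by rewrite [in LHS]mxE.
Qed.

(** Expand the nonnegative weighted sum of squared deviations of [y] from [a], the weighted sum
    itself. Mass missing from 1 only helps. *)
Lemma sqr_wsum_le (F : numDomainType) (I : finType) (m y : I -> F) :
  (forall i, 0 <= m i) -> \sum_i m i <= 1 -> (forall i, y i \is Num.real) ->
  (\sum_i m i * y i) ^+ 2 <= \sum_i m i * y i ^+ 2.
Proof.
move=> m0 m1 yr; set a := \sum_i m i * y i.
have ar : a \is Num.real.
  by apply: rpred_sum => i _; rewrite rpredM // ger0_real.
have : 0 <= \sum_i m i * (y i - a) ^+ 2.
  apply: sumr_ge0 => i _; rewrite mulr_ge0 // real_exprn_even_ge0 //.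
  exact: rpredB.
have -> : \sum_i m i * (y i - a) ^+ 2 =
    \sum_i m i * y i ^+ 2 - a ^+ 2 *+ 2 + (\sum_i m i) * a ^+ 2.
  rewrite expr2 -mulrnAl mulr_suml /a mulr_sumr -sumrB -big_split /=.
  by apply: eq_bigr => i _; rewrite -/a; ring.
have h : (\sum_i m i) * a ^+ 2 <= a ^+ 2.
  by rewrite ler_piMl // real_exprn_even_ge0.
move=> h0; rewrite -subr_ge0; apply: le_trans h0 _.
set S := \sum_i _; set mu := \sum_i _.
have -> : S - a ^+ 2 *+ 2 + mu * a ^+ 2 = S - a ^+ 2 - (a ^+ 2 - mu * a ^+ 2).
  by ring.
by rewrite gerBl subr_ge0.
Qed.

(** To first order in [t] the product is [1 + t * eta]: the second factor gains [t * (n + eta)] and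
    the power loses [n * t]. Bernoulli's inequality makes this rigorous. *)
Lemma exists_step (R : realFieldType) (n : nat) (eta : R) : 0 < eta ->
  exists t, [/\ 0 < t, t < 1 &
    1 < (1 - t) ^+ n * (1 + t / (1 - t) * (n%:R + eta))].
Proof.
move=> e0; have n0 : 0 <= n%:R :> R by rewrite ler0n.
have d0 : 0 < (n%:R + 1) * (n%:R + eta + 1) :> R by nra.
(* Small enough that the second-order loss [n * t ^ 2 * (n + eta)] stays below the gain
   [t * eta]. *)
pose t := eta / ((n%:R + 1) * (n%:R + eta + 1)).
have tE : t * ((n%:R + 1) * (n%:R + eta + 1)) = eta by rewrite /t divfK ?gt_eqF.
have t0 : 0 < t by rewrite divr_gt0.
have t1 : t < 1 by rewrite /t ltr_pdivrMr // mul1r; nra.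
have bern k : 1 - k%:R * t <= (1 - t) ^+ k.
  elim: k => [|k IH]; first by rewrite mul0r subr0 expr0.
  have k0 : 0 <= k%:R :> R by rewrite ler0n.
  rewrite exprS -natr1; apply: (@le_trans _ _ ((1 - t) * (1 - k%:R * t))).
    by nra.
  by rewrite ler_pM2l // subr_gt0.
have h1 : t * (n%:R + eta) <= t / (1 - t) * (n%:R + eta).
  rewrite ler_pM2r; last by rewrite ltr_wpDl.
  by rewrite ler_pdivlMr ?subr_gt0 //; nra.
exists t; split=> //.
apply: (@lt_le_trans _ _ ((1 - n%:R * t) * (1 + t * (n%:R + eta)))).
  have : n%:R * (t * (n%:R + eta)) < eta by rewrite -{2}tE; nra.
  nra.
apply: (@le_trans _ _ ((1 - t) ^+ n * (1 + t * (n%:R + eta)))).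
  by rewrite ler_pM2r // ltr_pwDl // mulr_ge0 ?ltW // ltr_wpDl.
by rewrite ler_wpM2l ?lerD2l // exprn_ge0 // subr_ge0 ltW.
Qed.

(** * Near D-optimal designs and inverses with small row sums *)

Section Design.
Context {R : realType} {s : scalars}.
Local Notation F := (scalar_field R s).
Local Notation conj := (@scalar_conj R s).
Context {N n : nat} (A : 'M[F]_(N, n)).

Definition adjmx m k (B : 'M[F]_(m, k)) : 'M[F]_(k, m) := (map_mx conj B)^T.

Lemma adjmxK m k (B : 'M[F]_(m, k)) : adjmx (adjmx B) = B.
Proof. by apply/matrixP => i j; rewrite !mxE scalar_conjK. Qed.

Lemma adjmx_mul m k l (B : 'M[F]_(m, k)) (C : 'M[F]_(k, l)) :
  adjmx (B *m C) = adjmx C *m adjmx B.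
Proof. by rewrite /adjmx map_mxM trmx_mul. Qed.

(** The information matrix of the design that puts mass [m g] on row [g] of [A]. *)
Definition gram (m : 'I_N -> F) : 'M[F]_n :=
  \sum_g m g *: (adjmx (row g A) *m row g A).

(** Mass at most 1, rather than exactly 1, keeps the uniform weights admissible when [N] is 0. *)
Definition subweights (m : 'I_N -> F) :=
  (forall g, 0 <= m g) /\ \sum_g m g <= 1.

Lemma gram_form m (x : 'rV[F]_n) :
  (x *m gram m *m adjmx x) 0 0 =
  \sum_g m g * `|(x *m adjmx (row g A)) 0 0| ^+ 2.
Proof.
rewrite /gram mulmx_sumr mulmx_suml summxE; apply: eq_bigr => g _.
rewrite -scalemxAr -scalemxAl mxE; congr (_ * _).
have -> : x *m (adjmx (row g A) *m row g A) *m adjmx x =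
    (x *m adjmx (row g A)) *m adjmx (x *m adjmx (row g A)).
  by rewrite adjmx_mul adjmxK !mulmxA.
rewrite -mul_scalar_conj.
by rewrite [LHS]mxE big_ord1 [in X in _ * X = _]mxE [in X in _ * X = _]mxE.
Qed.

Lemma gram_update (m : 'I_N -> F) t i :
  gram (fun g => (1 - t) * m g + t * (g == i)%:R) =
  (1 - t) *: gram m + t *: (adjmx (row i A) *m row i A).
Proof.
rewrite /gram scaler_sumr.
transitivity (\sum_g ((1 - t) *: (m g *: (adjmx (row g A) *m row g A)) +
   (t * (g == i)%:R) *: (adjmx (row g A) *m row g A))).
  by apply: eq_bigr => g _; rewrite scalerA -scalerDl.
rewrite big_split /=; congr (_ + _).
rewrite (bigD1 i) //= eqxx mulr1 big1 ?addr0 // => g /negbTE ->.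
by rewrite mulr0 scale0r.
Qed.

Lemma subweights_update m t i : subweights m -> 0 <= t <= 1 ->
  subweights (fun g => (1 - t) * m g + t * (g == i)%:R).
Proof.
move=> [m0 m1] /andP[t0 t1]; split=> [g|].
  by rewrite addr_ge0 ?mulr_ge0 ?subr_ge0.
have -> : \sum_g ((1 - t) * m g + t * (g == i)%:R) = (1 - t) * (\sum_g m g) + t.
  rewrite big_split /= -!mulr_sumr; congr (_ + _).
  rewrite -[RHS]mulr1; congr (_ * _).
  by rewrite (bigD1 i) //= eqxx big1 ?addr0 // => g /negbTE ->.
by rewrite -lerBrDr ler_piMr ?subr_ge0.
Qed.

(** Each weight is at most 1, so the entries of [gram m] are bounded uniformly in [m]; the Leibniz
    formula does the rest. *)
Lemma det_gram_bounded :
  exists B, forall m, subweights m -> `|\det (gram m)| <= B.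
Proof.
pose G k l := \sum_g `|(adjmx (row g A) *m row g A) k l|.
exists (\sum_(p : 'S_n) \prod_k G k (p k)) => m [m0 m1].
rewrite /determinant; apply: le_trans (ler_norm_sum _ _ _) _.
apply: ler_sum => p _; rewrite normrM normrX normrN1 expr1n mul1r normr_prod.
apply: ler_prod => k _; rewrite normr_ge0 /= /gram summxE.
apply: le_trans (ler_norm_sum _ _ _) _; apply: ler_sum => g _.
rewrite mxE normrM ler_piMl // ger0_norm //; apply: le_trans m1.
by rewrite (bigD1 g) //= lerDl sumr_ge0.
Qed.

(** A vector [x] in the left kernel annihilates the quadratic form, hence each of its terms. Then
    [A *m adjmx x] is 0, and a left inverse of [A] gives [x = 0]. *)
Lemma det_gram_uniform_neq0 :
  row_full A -> \det (gram (fun=> N%:R^-1)) != 0.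
Proof.
move=> /row_fullP[B BA]; apply/det0P => -[x x0 xG].
case/eqP: x0; have := gram_form (fun=> N%:R^-1) x.
rewrite xG mul0mx mxE => /esym/eqP; rewrite psumr_eq0; last first.
  by move=> g _; rewrite mulr_ge0 ?invr_ge0 ?exprn_ge0.
move=> /allP h.
have Ax : A *m adjmx x = 0.
  apply/row_matrixP => g; rewrite row_mul row0.
  have := h g (mem_index_enum _); rewrite mulf_eq0 invr_eq0 pnatr_eq0.
  (* The existence of the index [g] makes [N] positive, so the weight is nonzero. *)
  rewrite (gtn_eqF (leq_ltn_trans (leq0n g) (ltn_ord g))) /=.
  rewrite expf_eq0 /= normr_eq0 => /eqP E.
  have E' : x *m adjmx (row g A) = 0.
    by apply/matrixP => i j; rewrite !ord1 E mxE.
  by rewrite -[row g A]adjmxK -adjmx_mul E' /adjmx map_mx0 trmx0.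
rewrite -[x]adjmxK -[adjmx x]mul1mx -BA -mulmxA Ax mulmx0.
by rewrite /adjmx map_mx0 trmx0.
Qed.

Definition leverage m i := (row i A *m invmx (gram m) *m adjmx (row i A)) 0 0.

(** With [x] the row [i] of [A] times the inverse Gram matrix, row [i] is [x *m gram m], so the
    conjugate of the leverage is the quadratic form of [gram m] at [x]. That form is nonnegative,
    hence the conjugation disappears. *)
Lemma leverageE m i : (forall g, 0 <= m g) -> gram m \in unitmx ->
  leverage m i =
  \sum_g m g * `|(row i A *m invmx (gram m) *m adjmx (row g A)) 0 0| ^+ 2.
Proof.
move=> m0 uM; set S := RHS.
have S0 : 0 <= S by apply: sumr_ge0 => g _; rewrite mulr_ge0 ?exprn_ge0.
have : conj (leverage m i) = S.
  rewrite /S -gram_form mulmxKV // /leverage; set x := row i A *m _.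
  have -> : row i A *m adjmx x = adjmx (x *m adjmx (row i A)).
    by rewrite adjmx_mul adjmxK.
  by rewrite [in RHS]mxE [in RHS]mxE.
by move/(congr1 conj); rewrite scalar_conjK (scalar_conj_ge0 S0).
Qed.

(* Kiefer-Wolfowitz: at a near maximizer of |det (gram m)|, moving a fraction t
   of the mass to i multiplies the determinant by
   (1 - t)^n (1 + t / (1 - t) * leverage m i), which must be nearly at most 1. *)
Lemma exists_design (eta : R) : 0 < eta -> row_full A ->
  exists m, [/\ subweights m, gram m \in unitmx &
    forall i, leverage m i <= n%:R + scalar_of eta].
Proof.
move=> eta0 fA; have [t [t0 t1]] := exists_step n eta0.
(* [c] is the gain in determinant that a leverage of exactly [n + eta] would produce; as it exceeds
   1, it can serve as the tolerance for the near maximum. *)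
set c := _ * _ => c1; have [B hB] := det_gram_bounded.
have [||| m [Pm m0 hm]] := @exists_near_max R s _ subweights
    (fun m => `|\det (gram m)|) B (scalar_of c).
- by move=> m Pm; rewrite normr_ge0 hB.
- exists (fun=> N%:R^-1); last by rewrite normr_gt0 det_gram_uniform_neq0.
  split=> [g|]; first by rewrite invr_ge0.
  rewrite sumr_const card_ord -[leLHS]mulr_natl.
  have [->|N0] := eqVneq N 0%N; first by rewrite mul0r.
  by rewrite divff // pnatr_eq0.
- by rewrite -(rmorph1 scalar_of) scalar_of_lt.
have uM : gram m \in unitmx by rewrite unitmxE unitfE -normr_gt0.
exists m; split=> // i; have lE := leverageE i Pm.1 uM.
have l0 : 0 <= leverage m i.
  rewrite lE; apply: sumr_ge0 => g _; rewrite mulr_ge0 ?exprn_ge0 //.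
  exact: Pm.1.
have eta0' : 0 <= (scalar_of eta : F).
  by rewrite -(rmorph0 scalar_of) scalar_of_le ltW.
rewrite real_leNgt ?ger0_real ?addr_ge0 //; apply/negP => hl.
pose T : F := scalar_of t.
have T0 : 0 < T by rewrite -(rmorph0 scalar_of) scalar_of_lt.
have T1 : T < 1 by rewrite -(rmorph1 scalar_of) scalar_of_lt.
have T1' : 0 < 1 - T by rewrite subr_gt0.
have /hm : subweights (fun g => (1 - T) * m g + T * (g == i)%:R).
  by apply: subweights_update => //; rewrite !ltW.
rewrite gram_update det_add_rank1 ?lt_eqF // -/(leverage m i).
have q0 : 0 <= T / (1 - T) * leverage m i by rewrite mulr_ge0 // divr_ge0 ?ltW.
rewrite !normrM (ger0_norm (addr_ge0 ler01 q0)) normrX (gtr0_norm T1').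
rewrite -mulrA [X in _ * X]mulrC mulrA ler_pM2r //.
have cE : scalar_of c =
    (1 - T) ^+ n * (1 + T / (1 - T) * (n%:R + scalar_of eta)).
  by rewrite /c /T !(rmorphM, rmorphD, rmorphXn, rmorphN, rmorph1, fmorphV,
                     rmorph_nat).
rewrite cE ler_pM2l ?exprn_gt0 // lerD2l ler_pM2l ?divr_gt0 //.
by move=> /(lt_le_trans hl); rewrite ltxx.
Qed.

(** Weighted least squares: [H] is the inverse of [gram m] times the adjoint of [A] with columns
    weighted by [m]. By [sqr_wsum_le] the squared absolute row sum of [A *m H] is at most the
    leverage. *)
Lemma exists_left_inverse (eta : R) : 0 < eta -> row_full A ->
  exists H : 'M[F]_(n, N), H *m A = 1%:M /\
    forall i, (\sum_g `|(A *m H) i g|) ^+ 2 <= n%:R + scalar_of eta.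
Proof.
move=> eta0 fA; have [m [Pm uM hm]] := exists_design eta0 fA.
pose H : 'M[F]_(n, N) :=
  \matrix_(k, g) (m g * (invmx (gram m) *m adjmx (row g A)) k 0).
exists H; split.
  rewrite -[RHS](mulVmx uM); apply/matrixP => k l.
  rewrite [LHS]mxE /gram mulmx_sumr summxE; apply: eq_bigr => g _.
  by rewrite -scalemxAr mulmxA [RHS]mxE [in RHS]mxE big_ord1 !mxE mulrA.
move=> i; apply: le_trans (hm i); rewrite (leverageE _ Pm.1 uM).
apply: le_trans (sqr_wsum_le Pm.1 Pm.2 _); last first.
  by move=> g; rewrite normr_real.
rewrite le_eqVlt; apply/orP; left; apply/eqP; congr (_ ^+ 2).
apply: eq_bigr => g _.
have -> : (A *m H) i g =
    m g * (row i A *m invmx (gram m) *m adjmx (row g A)) 0 0.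
  rewrite -mulmxA mxE [in RHS]mxE mulr_sumr; apply: eq_bigr => k _.
  by rewrite [H _ _]mxE [row i A _ _]mxE mulrCA.
by rewrite normrM ger0_norm // Pm.1.
Qed.

End Design.

(** When the columns of [A] are dependent, a rank factorization reduces to its full-rank left
    factor: compose the left inverse of [col_base A] with a right inverse [Q] of [row_base A]. The
    bound then holds with the rank, which is at most [n]. *)
Lemma exists_pseudo_inverse (R : realType) (s : scalars) (N n : nat)
    (A : 'M[scalar_field R s]_(N, n)) (eta : R) : 0 < eta ->
  exists H : 'M[scalar_field R s]_(n, N), A *m H *m A = A /\
    forall i, (\sum_g `|(A *m H) i g|) ^+ 2 <= n%:R + scalar_of eta.
Proof.
move=> eta0.
have [H [HA hH]] := exists_left_inverse eta0 (col_base_full A).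
have /row_freeP[Q RQ] := row_base_free A.
exists (Q *m H).
have AQH : A *m (Q *m H) = col_base A *m H.
  by rewrite -{1}(mulmx_base A) mulmxA -[_ *m Q]mulmxA RQ mulmx1.
split=> [|i].
  have ->: A *m (Q *m H) *m A = col_base A *m H *m (col_base A *m row_base A).
    by rewrite AQH mulmx_base.
  by rewrite mulmxA -[_ *m col_base A]mulmxA HA mulmx1 mulmx_base.
rewrite AQH; apply: le_trans (hH i) _.
by rewrite lerD2r ler_nat rank_leq_col.
Qed.

(** * Spans, finite nets and elementary properties of widths *)

Section Spans.
Context {R : realType} {s : scalars} {X : normedModType (scalar_field R s)}.
Local Notation F := (scalar_field R s).
Implicit Types (K V Y S : set X) (x y : X).

Lemma rnorm_le x (a : R) : (rnorm x <= a) = (`|x| <= scalar_of a).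
Proof. by rewrite -(scalar_of_le (s := s)) scalar_ReK. Qed.

Lemma scalar_of_rnorm x : scalar_of (rnorm x) = `|x|.
Proof. by rewrite scalar_ReK. Qed.

Lemma rnorm_ge0 x : 0 <= rnorm x.
Proof. by rewrite -(scalar_of_le (s := s)) scalar_of_rnorm rmorph0. Qed.

Lemma rnormD x y : rnorm (x + y) <= rnorm x + rnorm y.
Proof. by rewrite rnorm_le rmorphD /= !scalar_of_rnorm ler_normD. Qed.

Lemma linear_subspaceP V :
  linear_subspace V <->
  V 0 /\ forall (a : F) x y, V x -> V y -> V (a *: x + y).
Proof.
split=> -[V0 VL]; split.
- by move: V0; rewrite inE.
- by move=> a x y Vx Vy; have := VL a x y; rewrite !inE; exact.
- by rewrite inE.
- by move=> a x y; rewrite !inE; exact: VL.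
Qed.

Lemma linear_subspace_sum V (I : finType) (a : I -> F) (v : I -> X) :
  linear_subspace V -> (forall i, V (v i)) -> V (\sum_i a i *: v i).
Proof.
move=> /linear_subspaceP[V0 VL] Vv; elim/big_rec: _ => // i x _ Vx.
exact: VL.
Qed.

Lemma linear_span_subspace S : linear_subspace (linear_span S).
Proof.
apply/linear_subspaceP; split=> [V [/linear_subspaceP[]]//|a x y Sx Sy V VS].
by have [/linear_subspaceP[_ VL] _] := VS; apply: VL; [exact: Sx|exact: Sy].
Qed.

Lemma sub_linear_span S : S `<=` linear_span S.
Proof. exact: sub_smallest. Qed.

Lemma linear_span_min S V :
  linear_subspace V -> S `<=` V -> linear_span S `<=` V.
Proof. exact: smallest_sub. Qed.

Lemma linear_span_rangeP n (v : 'I_n -> X) x :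
  linear_span (range v) x -> exists a : 'I_n -> F, x = \sum_i a i *: v i.
Proof.
apply: (@linear_span_min _
  [set x | exists a : 'I_n -> F, x = \sum_i a i *: v i]).
  apply/linear_subspaceP; split.
    by exists (fun=> 0); rewrite big1 // => i _; rewrite scale0r.
  move=> c _ _ [a ->] [b ->]; exists (fun i => c * a i + b i).
  rewrite scaler_sumr -big_split; apply: eq_bigr => i _ /=.
  by rewrite scalerDl scalerA.
move=> _ [i _ <-]; exists (fun j => (j == i)%:R).
rewrite (bigD1 i) //= eqxx scale1r big1 ?addr0 // => j /negbTE ->.
by rewrite scale0r.
Qed.

Lemma compact_finite_net K (eps : R) : compact K -> 0 < eps ->
  exists N (f : 'I_N -> X), (forall i, K (f i)) /\
    forall x, K x -> exists i, rnorm (x - f i) <= eps.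
Proof.
move=> cK eps0.
have e0 : 0 < scalar_of eps :> F.
  by rewrite -(rmorph0 scalar_of) scalar_of_lt.
move: cK; rewrite compact_cover.
move=> /(_ X K (fun x => (ball x (scalar_of eps : F))^°)) [].
- by move=> x _; exact: open_interior.
- by move=> x Kx; exists x => //; exact: nbhsx_ballx.
move=> D DK Dcov; pose l := finmap.enum_fset D.
exists (size l), (fun i => nth 0 l i); split=> [i|x /Dcov [y yD xy]].
  by apply/set_mem/DK; exact: mem_nth.
have il : (index y l < size l)%N by rewrite index_mem.
exists (Ordinal il) => /=; rewrite nth_index // rnorm_le -normrN opprB.
by apply: ltW; move/interior_subset: xy; rewrite -ball_normE.
Qed.

Lemma dist_to_ge0 V x : 0 <= dist_to V x.
Proof.
have [->|/set0P V0] := eqVneq V set0.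
  by rewrite /dist_to image_set0 inf0.
apply: lb_le_inf; first by case: V0 => v Vv; exists (rnorm (x - v)), v.
by move=> _ [v Vv <-]; exact: rnorm_ge0.
Qed.

Lemma dist_to_le V x v : V v -> dist_to V x <= rnorm (x - v).
Proof.
move=> Vv; apply: ge_inf; last by exists v.
by exists 0 => _ [w _ <-]; exact: rnorm_ge0.
Qed.

Lemma dist_to_adherent V x (d : R) : V !=set0 -> dist_to V x < d ->
  exists2 v, V v & rnorm (x - v) < d.
Proof.
move=> [v0 Vv0] hd; have [||_ [v Vv <-] hv] :=
  @inf_adherent _ [set rnorm (x - v) | v in V] (d - dist_to V x).
- by rewrite subr_gt0.
- split; first by exists (rnorm (x - v0)), v0.
  by exists 0 => _ [w _ <-]; exact: rnorm_ge0.
by exists v => //; move: hv; rewrite [X in _ < X]addrC subrK.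
Qed.

(** The real [sup] defaults to 0 on unbounded sets, so its use as a least upper bound rests on this.
    As 0 lies in [V], distances are at most norms, which a finite net of mesh 1 bounds. *)
Lemma dist_to_bounded K V : compact K -> linear_subspace V ->
  has_ubound [set dist_to V f | f in K].
Proof.
move=> cK /linear_subspaceP[V0 _].
have [N [f [_ hf]]] := compact_finite_net cK ltr01.
exists (1 + \sum_i rnorm (f i)) => _ [x Kx <-].
have [i hi] := hf x Kx; apply: le_trans (dist_to_le _ V0) _.
rewrite subr0 -[x](subrK (f i)); apply: le_trans (rnormD _ _) _.
apply: lerD => //; rewrite (bigD1 i) //= lerDl sumr_ge0 // => j _.
exact: rnorm_ge0.
Qed.

(** Nonnegativity of [M] covers the empty set, whose [sup] is 0. *)
Lemma ge_sup_ge0 (S : set R) (M : R) : 0 <= M -> ubound S M -> sup S <= M.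
Proof.
move=> M0 hM; have [->|/set0P S0] := eqVneq S set0; first by rewrite sup0.
exact: ge_sup.
Qed.

Lemma sup_dist_to_ge0 K V : compact K -> linear_subspace V ->
  0 <= sup [set dist_to V f | f in K].
Proof.
move=> cK sV; have [->|/set0P[x Kx]] := eqVneq K set0.
  by rewrite image_set0 sup0.
apply: le_trans (dist_to_ge0 V x) _; apply: ub_le_sup; last by exists x.
exact: dist_to_bounded.
Qed.

Lemma dim_le_span n (v : 'I_n -> X) : dim_le (linear_span (range v)) n.
Proof. by exists v. Qed.

Lemma linear_span0 n : linear_span (range (fun _ : 'I_n => 0 : X)) = [set 0].
Proof.
apply/seteqP; split.
  move=> x /linear_span_rangeP[a ->] /=.
  by rewrite big1 // => i _; rewrite scaler0.
move=> _ ->; set S := range _.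
by case/linear_subspaceP: (linear_span_subspace S).
Qed.

Definition admissible Y n : set (set X) :=
  [set V | [/\ linear_subspace V, V `<=` Y & dim_le V n]].

(** Rules out the default value of [inf] on the empty set; the zero space is the span of [n] zero
    vectors. *)
Lemma admissible_neq0 Y n : linear_subspace Y -> admissible Y n !=set0.
Proof.
move=> sY; exists [set 0]; rewrite -(linear_span0 n); split.
- exact: linear_span_subspace.
- by rewrite linear_span0 => _ ->; case/linear_subspaceP: sY.
- exact: dim_le_span.
Qed.

Lemma width_in_le Y n K V : compact K -> (0 < n)%N ->
  linear_subspace V -> V `<=` Y -> dim_le V n ->
  width_in Y n K <= sup [set dist_to V f | f in K].
Proof.
case: n => // n cK _ sV VY dV; apply: ge_inf; last by exists V.
by exists 0 => _ [W [sW _ _] <-]; exact: sup_dist_to_ge0.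
Qed.

Lemma kolmogorov_width_ge0 n K : compact K -> (0 < n)%N ->
  0 <= kolmogorov_width n K.
Proof.
case: n => // n cK _; apply: lb_le_inf.
  have [V VP] : admissible setT n.+1 !=set0.
    by apply: admissible_neq0; exact/linear_subspaceP.
  by exists (sup [set dist_to V f | f in K]), V.
by move=> _ [W [sW _ _] <-]; exact: sup_dist_to_ge0.
Qed.

Lemma kolmogorov_width_adherent n K (d : R) : (0 < n)%N -> compact K ->
  kolmogorov_width n K < d ->
  exists b : 'I_n -> X,
    sup [set dist_to (linear_span (range b)) f | f in K] < d.
Proof.
case: n => // n _ cK hd.
have [||_ [V [_ _ [b ->]] <-] hV] := @inf_adherent _
   [set sup [set dist_to V f | f in K] | V in admissible setT n.+1]
   (d - kolmogorov_width n.+1 K).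
- by rewrite subr_gt0.
- split.
    have [V VP] : admissible setT n.+1 !=set0.
      by apply: admissible_neq0; exact/linear_subspaceP.
    by exists (sup [set dist_to V f | f in K]), V.
  by exists 0 => _ [W [sW _ _] <-]; exact: sup_dist_to_ge0.
by exists b; move: hV; rewrite [X in _ < X]addrC subrK.
Qed.

Lemma kolmogorov_le_restricted n K : compact K ->
  kolmogorov_width n K <= restricted_kolmogorov_width n K.
Proof.
case: n => [|n] cK; first exact: lexx.
have [V VP] : admissible (linear_span K) n.+1 !=set0.
  by apply: admissible_neq0; exact: linear_span_subspace.
apply: lb_le_inf.
  exists (sup [set dist_to V f | f in K]), V => //.
  case: VP => sV VK dV; split=> //.
  exact: subset_trans VK (@subset_closure _ _).
by move=> _ [W [sW _ dW] <-]; exact: width_in_le.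
Qed.

(* Passing to finite nets of K reduces the comparison of the two widths to
   finite families of points, each given with an approximant in span(b). *)
Lemma restricted_width_le_of_finite n K (c : R) : (0 < n)%N -> compact K ->
  0 <= c ->
  (forall N (f : 'I_N -> X) (b : 'I_n -> X) (A : 'M[F]_(N, n)) (d : R),
     (forall i, rnorm (f i - \sum_j A i j *: b j) <= d) ->
     exists2 w : 'I_n -> X, forall j, linear_span (range f) (w j) &
       forall i, rnorm (f i - \sum_j A i j *: w j) <= c * d) ->
  restricted_kolmogorov_width n K <= c * kolmogorov_width n K.
Proof.
move=> n0 cK c0 H; apply/ler_addgt0Pr => e e0.
have c1 : 0 < 2 * c + 1 by rewrite ltr_wpDl // mulr_ge0.
(* Solves [c * (D + 2 * eps) + eps = c * D + e]. *)
pose eps := e / (2 * c + 1).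
have eps0 : 0 < eps by rewrite divr_gt0.
have epsE : eps * (2 * c + 1) = e by rewrite divfK // gt_eqF.
set D := kolmogorov_width n K.
have [b hb] : exists b : 'I_n -> X,
    sup [set dist_to (linear_span (range b)) f | f in K] < D + eps.
  by apply: kolmogorov_width_adherent => //; rewrite ltrDl.
have sb := linear_span_subspace (range b).
have [N [f [Kf hf]]] := compact_finite_net cK eps0.
(* One [eps] pays for a space that is only nearly optimal, the other for a distance that need not be
   attained. *)
have near i : exists a : 'I_n -> F,
    rnorm (f i - \sum_j a j *: b j) <= D + 2 * eps.
  have [||v /linear_span_rangeP[a ->] hv] :=
    @dist_to_adherent (linear_span (range b)) (f i) (D + 2 * eps).
  - by exists 0; case/linear_subspaceP: sb.
  - apply: le_lt_trans (_ : D + eps < _); last by lra.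
    apply: le_trans (ltW hb); apply: ub_le_sup; last by exists (f i).
    exact: dist_to_bounded.
  by exists a; exact: ltW.
have [a ha] := choice near.
have [i|w wf hw] := H N f b (\matrix_(i, j) a i j) (D + 2 * eps).
  by under eq_bigr do rewrite mxE; exact: ha.
have D0 : 0 <= D by exact: kolmogorov_width_ge0.
apply: le_trans (_ : c * (D + 2 * eps) + eps <= _); last by nra.
have wK j : linear_span K (w j).
  apply: linear_span_min (wf j); first exact: linear_span_subspace.
  by move=> _ [i _ <-]; apply: sub_linear_span; exact: Kf.
have sw := linear_span_subspace (range w).
apply: le_trans (width_in_le cK n0 sw _ (dim_le_span w)) _.
  apply: subset_trans (@subset_closure _ _).
  apply: linear_span_min; first exact: linear_span_subspace.
  by move=> _ [j _ <-].
apply: ge_sup_ge0; first by nra.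
(* The approximant of a nearby net point also serves [x], at the cost of one more [eps]. *)
move=> _ [x Kx <-]; have [i hi] := hf x Kx.
pose v := \sum_j a i j *: w j.
have vw : linear_span (range w) v.
  by apply: linear_subspace_sum => // j; apply: sub_linear_span; exists j.
apply: le_trans (dist_to_le x vw) _.
have -> : x - v = (f i - v) + (x - f i) by rewrite [RHS]addrC addrA subrK.
apply: le_trans (rnormD _ _) _; apply: lerD => //.
by move: (hw i); under eq_bigr do rewrite mxE.
Qed.

(** * The bound in a general Banach space *)

Lemma exists_sqrt_approximants N n (f : 'I_N -> X) (b : 'I_n -> X)
    (A : 'M[F]_(N, n)) (c d : R) :
  1 + Num.sqrt (n%:R : R) < c ->
  (forall i, rnorm (f i - \sum_j A i j *: b j) <= d) ->
  exists2 w : 'I_n -> X, forall j, linear_span (range f) (w j) &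
    forall i, rnorm (f i - \sum_j A i j *: w j) <= c * d.
Proof.
move=> hc hd.
have c1 : Num.sqrt (n%:R : R) < c - 1 by rewrite ltrBrDl.
have c10 : 0 <= c - 1 by apply: ltW; apply: le_lt_trans c1; exact: sqrtr_ge0.
(* With this [eta], [n + eta] is [(c - 1) ^+ 2], so the absolute row sums of [A *m H] are at most
   [c - 1]. *)
have eta0 : 0 < (c - 1) ^+ 2 - n%:R.
  rewrite subr_gt0 -[ltLHS](sqr_sqrtr (a := n%:R : R)) ?ler0n //.
  by rewrite ltr_pXn2r // nnegrE sqrtr_ge0.
have [H [AHA hH]] := exists_pseudo_inverse A eta0.
exists (fun j => \sum_g H j g *: f g) => [j|i].
  apply: linear_subspace_sum; first exact: linear_span_subspace.
  by move=> g; apply: sub_linear_span; exists g.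
have comb (y : 'I_N -> X) : \sum_j A i j *: (\sum_g H j g *: y g) =
    \sum_g (A *m H) i g *: y g.
  under eq_bigr do rewrite scaler_sumr; rewrite exchange_big /=.
  apply: eq_bigr => g _; rewrite mxE scaler_suml.
  by apply: eq_bigr => j _; rewrite scalerA.
pose v i := \sum_j A i j *: b j.
(* [A *m H *m A = A] says that [A *m H] reproduces the family [v]; the error at [f i] therefore
   splits into [f i - v i] and a combination of the [f g - v g]. *)
have vE : \sum_g (A *m H) i g *: v g = v i.
  under eq_bigr do rewrite scaler_sumr; rewrite exchange_big /=.
  rewrite /v -[in RHS]AHA; apply: eq_bigr => j _.
  rewrite [in RHS]mxE scaler_suml.
  by apply: eq_bigr => g _; rewrite scalerA.
have -> : f i - \sum_j A i j *: (\sum_g H j g *: f g) =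
    (f i - v i) - \sum_g (A *m H) i g *: (f g - v g).
  rewrite comb -{1}vE -addrA -opprD -big_split /=; congr (_ - _).
  by apply: eq_bigr => g _; rewrite scalerBr addrC subrK.
have d0 : 0 <= d := le_trans (rnorm_ge0 _) (hd i).
rewrite rnorm_le; apply: le_trans (ler_normB _ _) _.
have -> : c * d = d + (c - 1) * d by ring.
rewrite rmorphD; apply: lerD; first by rewrite -rnorm_le hd.
apply: le_trans (ler_norm_sum _ _ _) _.
apply: (@le_trans _ _ ((\sum_g `|(A *m H) i g|) * scalar_of d)).
  rewrite mulr_suml; apply: ler_sum => g _; rewrite normrZ ler_wpM2l //.
  by rewrite -rnorm_le hd.
rewrite rmorphM ler_wpM2r //.
  by rewrite -(rmorph0 scalar_of) scalar_of_le.
have := hH i; rewrite rmorphB rmorph_nat addrC subrK rmorphXn.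
rewrite ler_pXn2r // nnegrE ?sumr_ge0 //.
by rewrite -(rmorph0 scalar_of) scalar_of_le.
Qed.

Lemma restricted_width_le_sqrt n K : compact K ->
  restricted_kolmogorov_width n K
    <= (1 + Num.sqrt (n%:R : R)) * kolmogorov_width n K.
Proof.
have [->|n0] := posnP n; first by rewrite sqrtr0 addr0 mul1r.
move=> cK; set k := kolmogorov_width n K.
have k0 : 0 <= k by exact: kolmogorov_width_ge0.
apply/ler_addgt0Pr => e e0.
set c0 := 1 + Num.sqrt _.
have c00 : 0 <= c0 by rewrite addr_ge0 ?sqrtr_ge0.
(* This slack in the constant costs at most [e] after multiplication by [k]; the added 1 keeps the
   denominator positive when [k] is 0. *)
have d0 : 0 < e / (k + 1) by rewrite divr_gt0 // ltr_wpDl.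
apply: (@le_trans _ _ ((c0 + e / (k + 1)) * k)).
  apply: restricted_width_le_of_finite => //; first by rewrite addr_ge0 // ltW.
  move=> N f b A d; apply: exists_sqrt_approximants.
  by rewrite ltrDl.
rewrite mulrDl lerD2l mulrAC ler_pdivrMr ?ltr_wpDl //.
by rewrite ler_pM2l // lerDl.
Qed.

End Spans.

(** * Orthogonal projection and the Hilbert space case *)

Section InnerProduct.
Context {R : realType} {s : scalars} {X : normedModType (scalar_field R s)}.
Local Notation F := (scalar_field R s).
Context (ip : {dot X for @scalar_conj R s})
  (ip_norm : forall x : X, `|x| ^+ 2 = ip x x).
Implicit Types (x y z u h : X) (S K : set X).

Lemma ip_linear (a : F) x y z : ip (a *: x + y) z = a * ip x z + ip y z.
Proof. by rewrite linearPl. Qed.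

Lemma ip_conj x y : ip x y = scalar_conj (ip y x).
Proof. by rewrite hermC expr0 mul1r. Qed.

(** The element of [S] takes the linear slot, so that the condition passes directly to spans. *)
Definition orth u S := forall h, S h -> ip h u = 0.

Lemma orth_span u S : orth u S -> orth u (linear_span S).
Proof.
move=> uS; apply: linear_span_min => //.
apply/linear_subspaceP; split; first by rewrite /= linear0l.
by move=> a x y /= hx hy; rewrite ip_linear hx hy mulr0 addr0.
Qed.

Lemma orth_subspace S : linear_subspace [set u | orth u S].
Proof.
apply/linear_subspaceP; split=> [h _|a x y ox oy h Sh].
  by rewrite ip_conj linear0l rmorph0.
rewrite ip_conj ip_linear rmorphD rmorphM /= -!ip_conj (ox h Sh) (oy h Sh).
by rewrite mulr0 addr0.
Qed.

(** Gram-Schmidt along the list: [g'] is [g] made orthogonal to the other vectors, and the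
    projection [p] onto their span is corrected along [g']. *)
Lemma exists_projection (l : seq X) x :
  exists2 p, linear_span [set` l] p & orth (x - p) [set` l].
Proof.
elim: l x => [|g l IH] x.
  exists 0; last by move=> h; rewrite /= in_nil.
  by case/linear_subspaceP: (linear_span_subspace [set` [::] : seq X]).
set L := [set` g :: l].
have /linear_subspaceP[_ sL] := linear_span_subspace L.
have lL : linear_span [set` l] `<=` linear_span L.
  apply: linear_span_min; first exact: linear_span_subspace.
  by move=> h hl; apply: sub_linear_span; rewrite /L /= in_cons hl orbT.
have gL : linear_span L g by apply: sub_linear_span; rewrite /L /= mem_head.
have [p pl xp] := IH x; have [q ql gq] := IH g.
pose g' := g - q; pose c := ip (x - p) g' / ip g' g'.
have g'L : linear_span L g'.
  by rewrite /g' addrC -scaleN1r; apply: sL => //; exact: lL.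
exists (c *: g' + p); first by apply: sL => //; exact: lL.
have oE : x - (c *: g' + p) = (- c) *: g' + (x - p).
  by rewrite scaleNr opprD addrCA.
have ol : orth (x - (c *: g' + p)) [set` l].
  have /linear_subspaceP[_] := orth_subspace [set` l].
  by rewrite oE; apply.
have og' : ip (x - (c *: g' + p)) g' = 0.
  rewrite oE ip_linear mulNr /c.
  (* If [g] already lies in the span of the others, [g'] is 0 and orthogonality to it is trivial. *)
  have [g0|g0] := eqVneq (ip g' g') 0; last by rewrite divfK // addNr.
  have g'0 : g' = 0 by apply/eqP; rewrite -normr_eq0 -sqrf_eq0 ip_norm g0.
  by rewrite g0 mulr0 oppr0 add0r ip_conj g'0 linear0l rmorph0.
move=> h; rewrite /L /= in_cons => /orP[/eqP ->|]; last exact: ol.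
have -> : g = 1 *: g' + q by rewrite scale1r subrK.
by rewrite ip_linear (orth_span ol ql) ip_conj og' rmorph0 mulr0 addr0.
Qed.

(** Pythagoras, in squared norms. *)
Lemma orth_norm_le x y : ip x y = 0 -> `|x| <= `|x - y|.
Proof.
move=> xy0; rewrite -(@ler_pXn2r _ 2) ?nnegrE // !ip_norm.
have yx0 : ip y x = 0 by rewrite ip_conj xy0 rmorph0.
rewrite linearBl /= !linearBr /= xy0 yx0 subr0 sub0r opprK.
by rewrite lerDl -ip_norm exprn_ge0.
Qed.

(** Take [w j] to be the projection of [b j] onto the span of [f], keeping the coefficients [A]. The
    old error is the new one, which lies in that span, minus a vector orthogonal to it. *)
Lemma exists_orthogonal_approximants N n (f : 'I_N -> X) (b : 'I_n -> X)
    (A : 'M[F]_(N, n)) (d : R) :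
  (forall i, rnorm (f i - \sum_j A i j *: b j) <= d) ->
  exists2 w : 'I_n -> X, forall j, linear_span (range f) (w j) &
    forall i, rnorm (f i - \sum_j A i j *: w j) <= d.
Proof.
move=> hd.
have lf : [set` codom f] = range f.
  apply/seteqP; split=> [x /= /codomP[i ->]|_ [i _ <-]]; first by exists i.
  exact: codom_f.
have proj j : exists p, linear_span (range f) p /\ orth (b j - p) (range f).
  by rewrite -lf; have [p] := exists_projection (codom f) (b j); exists p.
have [w hw] := choice proj; exists w => [j|i]; first by case: (hw j).
have sf := linear_span_subspace (range f).
have os : orth (\sum_j A i j *: (b j - w j)) (range f).
  apply: (linear_subspace_sum _ (orth_subspace (range f))) => j.
  by case: (hw j).
rewrite rnorm_le.
apply: (@le_trans _ _ `|f i - \sum_j A i j *: b j|); last first.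
  by rewrite -rnorm_le hd.
have -> : f i - \sum_j A i j *: b j =
    (f i - \sum_j A i j *: w j) - \sum_j A i j *: (b j - w j).
  under [X in _ = _ - X]eq_bigr do rewrite scalerBr.
  by rewrite sumrB opprB addrA subrK.
apply: orth_norm_le; apply: (orth_span os).
have /linear_subspaceP[_ sL] := sf.
rewrite addrC -scaleN1r; apply: sL; last by apply: sub_linear_span; exists i.
by apply: linear_subspace_sum => // j; case: (hw j).
Qed.

Lemma restricted_width_eq n K : compact K ->
  restricted_kolmogorov_width n K = kolmogorov_width n K.
Proof.
move=> cK; have [->//|n0] := posnP n.
apply/eqP; rewrite eq_le kolmogorov_le_restricted // andbT.
rewrite -[leRHS]mul1r; apply: restricted_width_le_of_finite => //.
move=> N f b A d; rewrite mul1r; exact: exists_orthogonal_approximants.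
Qed.

End InnerProduct.

Theorem theorem4p2 (R : realType) (s : scalars)
    (X : completeNormedModType (scalar_field R s)) (K : set X) :
  compact K ->
  (forall n : nat,
     restricted_kolmogorov_width n K
       <= (1 + Num.sqrt (n%:R : R)) * kolmogorov_width n K) /\
  (is_hilbert X ->
   forall n : nat, restricted_kolmogorov_width n K = kolmogorov_width n K).
Proof.
move=> cK; split=> [n|[ip ip_norm] n]; first exact: restricted_width_le_sqrt.
exact: (restricted_width_eq ip_norm).
Qed.
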